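(* Let $m,n\ge 1$, let $\Omega\subseteq\{1,\dots,m\}\times\{1,\dots,n\}$, let $A_{ij}>0$ for $(i,j)\in\Omega$, and let $\theta\in\{0,1\}$. Let $G$ be the (simple, undirected) graph with vertex set $\{1,\dots,m+n\}$ and edges $\{i,m+j\}$, $(i,j)\in\Omega$. Suppose that (a) $G$ is connected, and (b) every block of $G$ is either an edge or a cycle. For a cone $\mathcal C\subseteq\mathbb S^{m+n}$ consider the problem $$ \mathrm{(D}_{\mathcal C}\mathrm{)}\qquad \begin{array}{rl} \max\limits_{\mu_0,\lambda,w} & -\mu_0\\ \text{s.t.} & (1+\lambda)I+\sum\limits_{(i,j)\in\Omega}(\theta\rho-w_{i,j})E_{i,m+j}+\Big(\mu_0-r\lambda+\sum\limits_{(i,j)\in\Omega}2A_{ij}w_{i,j}\Big)E_{11}\in\mathcal C,\\ & \mu_0\in\mathbb R,\quad \lambda\ge 0,\quad w\in\mathbb R^{\Omega},\quad \theta w_{i,j}\ge 0\ \ ((i,j)\in\Omega). \end{array} $$ Then the problems $(\mathrm D_{\mathcal C})$ with $\mathcal C=\mathcal{SPN}^{m+n}$ and with $\mathcal C=\mathcal{COP}^{m+n}$ are equivalent, i.e. they have the same optimal value.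
   Context: $\mathbb S^s$ is the set of real symmetric $s\times s$ matrices. $E_{ii}=e^i(e^i)^T$ and $E_{ij}=e^i(e^j)^T+e^j(e^i)^T$ for $i\ne j$, where $e^i$ is the $i$th unit vector. Cones: $\mathbb S^s_+$ is the positive semidefinite cone; $\mathbb N^s$ is the cone of elementwise nonnegative symmetric matrices; $\mathcal{SPN}^s=\mathbb S^s_++\mathbb N^s$ (dual of the doubly nonnegative cone $\mathbb S^s_+\cap\mathbb N^s$); $\mathcal{COP}^s=\{M\in\mathbb S^s: x^TMx\ge 0\ \forall x\in\mathbb R^s_+\}$ is the copositive cone (dual of the completely positive cone). A cut vertex of a graph is a vertex whose removal increases the number of connected components; a block of a graph is a maximal (connected) subgraph with no cut vertex. $r>0$ and $\rho>0$ are fixed constants which are taken sufficiently large: the claim is asserted for all $r\ge r_0$ and $\rho\ge\rho_0$, for some thresholds $r_0,\rho_0>0$ depending only on the data $m,n,\Omega,A$. The optimal value of a maximization problem is the supremum of its objective over its feasible set, in $[-\infty,+\infty]$. *)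

(* Defs.v *)
From HB Require Import structures.
From mathcomp Require Import all_boot all_order all_algebra.
From mathcomp Require Import all_classical all_reals all_analysis.

Set Implicit Arguments.
Unset Strict Implicit.
Unset Printing Implicit Defensive.

Import Order.TTheory GRing.Theory Num.Theory.

(* A simple undirected graph on vertices of T; an edge {x, y} is the
   two-element set [set x; y], see [wf_graph]. *)
Record sgraph (T : finType) := SGraph {
  vset : {set T};
  eset : {set {set T}}
}.

Section Graphs.
Variable T : finType.
Implicit Types (G H B : sgraph T) (v x y : T).

Definition wf_graph G : bool :=
  [forall e in eset G, (e \subset vset G) && (#|e| == 2)].

Definition adj G : rel T := fun x y => [set x; y] \in eset G.

Definition ncomp G : nat := n_comp (adj G) (vset G).

Definition gconnected G : bool := ncomp G == 1.

Definition del_vertex G v : sgraph T :=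
  SGraph (vset G :\ v) [set e in eset G | v \notin e].

Definition cut_vertex G v : bool :=
  (v \in vset G) && (ncomp G < ncomp (del_vertex G v)).

Definition subgraph H G : bool :=
  [&& wf_graph H, vset H \subset vset G & eset H \subset eset G].

Definition connected_no_cut H : Prop :=
  gconnected H /\ forall v, ~~ cut_vertex H v.

Definition is_block G B : Prop :=
  [/\ subgraph B G, connected_no_cut B &
      forall H, subgraph H G -> connected_no_cut H -> subgraph B H -> H = B].

Definition is_edge_graph B : Prop :=
  exists x y, [/\ x != y, vset B = [set x; y] & eset B = [set [set x; y]]].

Definition is_cycle_graph B : Prop :=
  exists s : seq T, [/\ uniq s, 2 < size s, vset B = [set x in s] &
    eset B = [set [set x; next s x] | x in s]].

End Graphs.

Definition bipartite_graph (m n : nat) (Omega : {set 'I_m * 'I_n}) :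
    sgraph 'I_(m + n) :=
  SGraph [set: 'I_(m + n)]
         [set [set lshift n p.1; rshift m p.2] | p in Omega].

Local Open Scope classical_set_scope.
Local Open Scope ring_scope.

Section Cones.
Variables (R : realType) (s : nat).

Definition Esym (i j : 'I_s) : 'M[R]_s :=
  if i == j then delta_mx i i else delta_mx i j + delta_mx j i.

Definition psd_cone : set 'M[R]_s :=
  [set M | M^T = M /\ forall x : 'cV[R]_s, 0 <= (x^T *m M *m x) 0 0].

Definition nonneg_cone : set 'M[R]_s :=
  [set M | M^T = M /\ forall i j, 0 <= M i j].

Definition SPN : set 'M[R]_s :=
  [set P + N | P in psd_cone & N in nonneg_cone].

Definition COP : set 'M[R]_s :=
  [set M | M^T = M /\ forall x : 'cV[R]_s, (forall i, 0 <= x i 0) ->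
     0 <= (x^T *m M *m x) 0 0].

End Cones.

Arguments SPN : clear implicits.
Arguments COP : clear implicits.

Section DualProblem.
Variables (R : realType) (m n : nat) (m_gt0 : (0 < m)%N).
Variable Omega : {set 'I_m * 'I_n}.

Definition obs : Type := {p : 'I_m * 'I_n | p \in Omega}.
HB.instance Definition _ := Finite.on obs.

Variables (A : obs -> R) (theta r rho : R).

Let row_vtx (p : obs) : 'I_(m + n) := lshift n (val p).1.
Let col_vtx (p : obs) : 'I_(m + n) := rshift m (val p).2.
Let first_vtx : 'I_(m + n) := lshift n (Ordinal m_gt0).

Definition dual_matrix (mu0 lambda : R) (w : obs -> R) : 'M[R]_(m + n) :=
  (1 + lambda)%:M
  + \sum_(p : obs) (theta * rho - w p) *: Esym R (row_vtx p) (col_vtx p)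
  + (mu0 - r * lambda + \sum_(p : obs) 2 * A p * w p)
      *: Esym R first_vtx first_vtx.

Definition dual_feasible (C : set 'M[R]_(m + n))
    (mu0 lambda : R) (w : obs -> R) : Prop :=
  [/\ C (dual_matrix mu0 lambda w), 0 <= lambda & forall p, 0 <= theta * w p].

Definition dual_value (C : set 'M[R]_(m + n)) : \bar R :=
  ereal_sup [set z | exists mu0 lambda w,
    dual_feasible C mu0 lambda w /\ z = (- mu0)%:E].

End DualProblem.

(* Main.v *)
Require Import Defs.
From HB Require Import structures.
From mathcomp Require Import all_boot all_order all_algebra.
From mathcomp Require Import all_classical all_reals all_analysis.
From mathcomp Require Import ring lra.

Import Order.TTheory GRing.Theory Num.Theory.
Local Open Scope ring_scope.

(** The two problems have the same feasible points.  Every dual matrix is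
    symmetric and, off the diagonal, it vanishes outside the edges of the graph
    G; and when every block of G is an edge or a cycle, a copositive matrix M
    with that zero pattern is the sum of a positive semidefinite and a
    nonnegative matrix ([SPN_cactus]).  The converse inclusion [SPN_COP] holds
    for all matrices, so the two suprema are taken over the same set.

    [SPN_cactus] goes by induction on the set U of vertices that carries M.

    - If the graph induced on U is disconnected, M is block diagonal, and its
      blocks are carried by smaller sets ([SPN_split]).

    - If the induced graph has a cut vertex v, M splits as M1 + M2 along
      v: only the diagonal entry at v is shared, and it can be divided so that
      M1 and M2 are both copositive ([COP_cut_split]).  Minimizing the form of M over the
      vectors with v-coordinate 1 is a pair of independent minimizations, one
      on each side of v; hence the least entries at v that make the two sides
      copositive add up to at most M v v.

    - Otherwise the induced graph is connected without cut vertex, so it lies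
      in a block, that is in an edge or a cycle, and [SPN_cycle] applies.

    [SPN_cycle] goes by induction on the length of the cycle.  If no entry
    between a vertex k and another vertex is positive and M k k is positive,
    then the form on nonnegative vectors, minimized over the k-th coordinate,
    has its minimizer at a nonnegative value.  Hence the Schur complement at k is
    again copositive ([COP_schur]), it is carried by the cycle with k bypassed
    ([cycle_support_schur]), and it differs from M by a positive semidefinite
    matrix of rank one ([SPN_schur]).  If M k k is zero, row k vanishes and k
    can be deleted.  If every vertex touches a positive entry and the cycle has
    at least three vertices, then two of its edges carry positive entries; they
    cut the cycle into two shorter arcs, and these entries go to the
    nonnegative part. *)

(** * Quadratic forms and the cones *)

Section CopositiveMatrices.
Set Implicit Arguments.
Unset Strict Implicit.
Unset Printing Implicit Defensive.
Context {R : realType} {s : nat}.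
Implicit Types (M N : 'M[R]_s) (x y : 'I_s -> R) (W : {set 'I_s}) (k v : 'I_s).

Definition qf M x : R := \sum_i \sum_j x i * M i j * x j.

Lemma qf_mulmx M (x : 'cV[R]_s) :
  (x^T *m M *m x) 0 0 = qf M (fun i => x i 0).
Proof.
rewrite mxE /qf exchange_big /=; apply: eq_bigr => j _.
rewrite mxE big_distrl /=; apply: eq_bigr => i _.
by rewrite mxE.
Qed.

Lemma psdP M : psd_cone M <-> M^T = M /\ forall x, 0 <= qf M x.
Proof.
split=> -[sM H]; split=> // x.
  have := H (\col_i x i); rewrite qf_mulmx.
  by congr (0 <= qf M _); apply/funext => i; rewrite mxE.
by rewrite qf_mulmx.
Qed.

Lemma COPP M :
  COP R s M <-> M^T = M /\ forall x, (forall i, 0 <= x i) -> 0 <= qf M x.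
Proof.
split=> -[sM H]; split=> // x x0.
  have := H (\col_i x i); rewrite qf_mulmx.
  have -> : (fun i => (\col_i x i) i 0) = x by apply/funext => i; rewrite mxE.
  by apply => i; rewrite mxE.
by rewrite qf_mulmx; apply: H.
Qed.

Lemma qfD M N x : qf (M + N) x = qf M x + qf N x.
Proof.
rewrite /qf -big_split; apply: eq_bigr => i _ /=.
by rewrite -big_split; apply: eq_bigr => j _ /=; rewrite mxE; ring.
Qed.

Lemma qfZ (c : R) M x : qf (c *: M) x = c * qf M x.
Proof.
rewrite /qf big_distrr; apply: eq_bigr => i _ /=.
by rewrite big_distrr; apply: eq_bigr => j _ /=; rewrite mxE; ring.
Qed.

Lemma qf_homog M x (c : R) : qf M (fun i => c * x i) = c ^+ 2 * qf M x.
Proof.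
rewrite /qf big_distrr; apply: eq_bigr => i _ /=.
by rewrite big_distrr; apply: eq_bigr => j _ /=; ring.
Qed.

Lemma qf_outer (u : 'I_s -> R) x :
  qf (\matrix_(i, j) (u i * u j)) x = (\sum_i u i * x i) ^+ 2.
Proof.
rewrite expr2 big_distrl; apply: eq_bigr => i _ /=.
by rewrite big_distrr; apply: eq_bigr => j _ /=; rewrite mxE; ring.
Qed.

Lemma qf_delta v x : qf (delta_mx v v) x = x v ^+ 2.
Proof.
have -> : delta_mx v v = \matrix_(i, j) ((i == v)%:R * (j == v)%:R) :> 'M[R]_s.
  by apply/matrixP => i j; rewrite !mxE -natrM mulnb.
rewrite qf_outer; congr (_ ^+ 2).
rewrite (bigD1 v) //= eqxx mul1r big1 ?addr0 // => i /negPf ->.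
by rewrite mul0r.
Qed.

Lemma qf_shift M x k (t : R) : M^T = M ->
  qf M (fun i => x i + t * (i == k)%:R) =
  qf M x + 2 * t * (\sum_j M k j * x j) + t ^+ 2 * M k k.
Proof.
move=> sM.
have sel (F : 'I_s -> R) : \sum_j F j * (j == k)%:R = F k.
  rewrite (bigD1 k) //= eqxx mulr1 big1 ?addr0 // => j /negPf ->.
  by rewrite mulr0.
have symM i j : M i j = M j i by rewrite -[in LHS]sM mxE.
have E i : \sum_j (x i + t * (i == k)%:R) * M i j * (x j + t * (j == k)%:R) =
    \sum_j x i * M i j * x j + (t * (\sum_j M i j * x j)) * (i == k)%:R
    + t * x i * M i k + t ^+ 2 * M i k * (i == k)%:R.
  have <- := sel (fun j => t * x i * M i j).
  have <- := sel (fun j => t ^+ 2 * M i j).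
  rewrite !big_distrr /= !big_distrl -!big_split; apply: eq_bigr => j _ /=.
  by ring.
rewrite /qf (eq_bigr _ (fun i _ => E i)) !big_split /= !sel.
have -> : \sum_i t * x i * M i k = t * \sum_j M k j * x j.
  by rewrite big_distrr; apply: eq_bigr => i _ /=; rewrite (symM i k); ring.
by ring.
Qed.

Lemma SPN_add M N : SPN R s M -> SPN R s N -> SPN R s (M + N).
Proof.
move=> [P /psdP [sP HP]] [Q [sQ HQ] <-] [P' /psdP [sP' HP']] [Q' [sQ' HQ'] <-].
exists (P + P').
  apply/psdP; split=> [|x]; first by rewrite linearD /= sP sP'.
  by rewrite qfD addr_ge0.
exists (Q + Q'); last by rewrite addrACA.
by split=> [|i j]; [by rewrite linearD /= sQ sQ'|by rewrite mxE addr_ge0].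
Qed.

Lemma psd_SPN M : psd_cone M -> SPN R s M.
Proof.
move=> HM; exists M => //; exists 0; last by rewrite addr0.
by split=> [|i j]; [rewrite linear0|rewrite mxE].
Qed.

Lemma nonneg_SPN M : nonneg_cone M -> SPN R s M.
Proof.
move=> HM; exists 0; last by exists M => //; rewrite add0r.
apply/psdP; split=> [|x]; first by rewrite linear0.
by rewrite -(scale0r M) qfZ mul0r.
Qed.

Lemma SPN_COP M : SPN R s M -> COP R s M.
Proof.
move=> [P /psdP [sP HP] [N [sN HN] <-]]; apply/COPP.
split=> [|x x0]; first by rewrite linearD /= sP sN.
rewrite qfD addr_ge0 //; apply: sumr_ge0 => i _; apply: sumr_ge0 => j _.
by rewrite !mulr_ge0.
Qed.

Lemma COP_sym M i j : COP R s M -> M i j = M j i.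
Proof. by move=> [sM _]; rewrite -[in LHS]sM mxE. Qed.

Lemma COP_diag M k : COP R s M -> 0 <= M k k.
Proof.
move=> /COPP [sM H].
have := H (fun i => 0 + 1 * (i == k)%:R); rewrite qf_shift //.
have -> : qf M (fun=> 0) = 0.
  by apply: big1 => i _; apply: big1 => j _; rewrite mulr0.
rewrite big1 => [|j _]; last by rewrite mulr0.
rewrite mulr0 expr1n mul1r !add0r; apply => i.
by rewrite add0r mul1r ler0n.
Qed.

(** A negative entry M k i would make the form tend to minus infinity along
    e_i + t e_k, where it is affine in t. *)
Lemma COP_zero_diag M k i : COP R s M -> M k k = 0 -> 0 <= M k i.
Proof.
move=> cM Mkk; rewrite leNgt; apply/negP => Mki.
have /COPP [sM H] := cM; have Mii := COP_diag i cM.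
(* the value of t at which M i i + 2 t M k i equals -1 *)
pose t := (M i i + 1) / (- (2 * M k i)).
have t0 : 0 <= t by rewrite divr_ge0 //; lra.
have := H (fun j => (j == i)%:R + t * (j == k)%:R) _.
rewrite qf_shift // Mkk mulr0 addr0.
have -> : qf M (fun j => (j == i)%:R) = M i i.
  rewrite /qf (bigD1 i) //= (bigD1 i) //= eqxx mul1r mulr1.
  rewrite big1 => [|j /negPf ->]; last by rewrite mulr0.
  rewrite big1 ?addr0 // => j /negPf ->.
  by apply: big1 => l _; rewrite !mul0r.
have -> : \sum_j M k j * (j == i)%:R = M k i.
  rewrite (bigD1 i) //= eqxx mulr1 big1 ?addr0 // => j /negPf ->.
  by rewrite mulr0.
have -> : M i i + 2 * t * M k i = -1.
  by rewrite /t; field; rewrite lt_eqF.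
move=> H1; have : 0 <= -1 :> R; last by lra.
by apply: H1 => j; apply: addr_ge0; [|apply: mulr_ge0 => //]; apply: ler0n.
Qed.

(** * Splitting and eliminating vertices *)

(** The principal submatrix on W, padded with zeros to keep the index type. *)
Definition restrict W M : 'M[R]_s :=
  \matrix_(i, j) if (i \in W) && (j \in W) then M i j else 0.

Lemma qf_restrict W M x :
  qf (restrict W M) x = qf M (fun i => if i \in W then x i else 0).
Proof.
apply: eq_bigr => i _; apply: eq_bigr => j _; rewrite mxE.
by case: (i \in W); case: (j \in W) => /=; rewrite ?(mulr0, mul0r).
Qed.

Lemma restrict_sym W M : M^T = M -> (restrict W M)^T = restrict W M.
Proof.
by move=> sM; apply/matrixP => i j; rewrite !mxE andbC -[in LHS]sM mxE.
Qed.

Lemma COP_restrict W M : COP R s M -> COP R s (restrict W M).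
Proof.
move=> /COPP [sM H]; apply/COPP; split; first exact: restrict_sym.
by move=> x x0; rewrite qf_restrict; apply: H => i; case: ifP.
Qed.

(** The entries between W and its complement form a nonnegative matrix, so only
    the two diagonal blocks need a decomposition. *)
Lemma SPN_split M W : COP R s M ->
  (forall i j, i \in W -> j \notin W -> 0 <= M i j) ->
  SPN R s (restrict W M) -> SPN R s (restrict (~: W) M) -> SPN R s M.
Proof.
move=> cM H S1 S2.
have -> : M = restrict W M + restrict (~: W) M
   + \matrix_(i, j) (if (i \in W) (+) (j \in W) then M i j else 0).
  apply/matrixP => i j; rewrite !mxE !inE.
  by case: (i \in W); case: (j \in W) => /=; rewrite ?(addr0, add0r).
apply: SPN_add; first exact: SPN_add.
apply: nonneg_SPN; split=> [|i j].
  by apply/matrixP => i j; rewrite !mxE addbC (COP_sym _ _ cM).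
rewrite mxE; case: (boolP (i \in W)); case: (boolP (j \in W)) => //= hj hi.
  exact: H.
by rewrite (COP_sym _ _ cM); apply: H.
Qed.

(** The Schur complement at k; its row and column k vanish, which again keeps
    the index type. *)
Definition schur k M : 'M[R]_s :=
  M - (M k k)^-1 *: \matrix_(i, j) (M k i * M k j).

(** The form of the Schur complement at x is the form of M at x with the k-th
    coordinate moved to the unconstrained minimizer.  That minimizer is
    nonnegative by the sign condition on row k, so copositivity of M applies. *)
Lemma COP_schur k M : COP R s M -> 0 < M k k ->
  (forall i, i != k -> M k i <= 0) -> COP R s (schur k M).
Proof.
move=> cM Mk0 Mki; have /COPP [sM H] := cM.
apply/COPP; split=> [|x x0].
  rewrite /schur linearB linearZ /= sM; congr (_ - _ *: _).
  by apply/matrixP => i j; rewrite !mxE mulrC.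
pose L := \sum_j M k j * x j; pose t := - L / M k k.
have -> : qf (schur k M) x = qf M (fun i => x i + t * (i == k)%:R).
  rewrite qf_shift // /schur -scaleN1r scalerA qfD qfZ qf_outer -/L /t.
  by field; rewrite gt_eqF.
apply: H => i; case: eqP => [->|_]; last by rewrite mulr0 addr0.
have -> : x k + t * 1 = (- \sum_(j | j != k) M k j * x j) / M k k.
  by rewrite /t /L (bigD1 k) //=; field; rewrite gt_eqF.
apply: divr_ge0; last exact: ltW.
rewrite oppr_ge0; apply: sumr_le0 => j jk.
by rewrite mulr_le0_ge0 ?Mki.
Qed.

Lemma SPN_schur k M : 0 <= M k k -> SPN R s (schur k M) -> SPN R s M.
Proof.
move=> Mk0 H.
rewrite -[M](subrK ((M k k)^-1 *: \matrix_(i, j) (M k i * M k j))).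
apply: SPN_add => //; apply: psd_SPN; apply/psdP; split=> [|x].
  rewrite linearZ /=; congr (_ *: _).
  by apply/matrixP => i j; rewrite !mxE mulrC.
by rewrite qfZ qf_outer mulr_ge0 ?invr_ge0 ?sqr_ge0.
Qed.

(** Both padded submatrices contain the entry at v, which is thus counted
    twice. *)
Lemma cut_decomposition M v W : M^T = M -> v \notin W ->
  (forall i j, i \in W -> j \notin W -> j != v -> M i j = 0) ->
  M = restrict (v |: W) M + restrict (~: W) M + (- M v v) *: delta_mx v v.
Proof.
move=> sM vW M0; apply/matrixP => i j; rewrite !mxE !inE.
have symM i' j' : M i' j' = M j' i' by rewrite -[in LHS]sM mxE.
have [->|iv] := eqVneq i v; have [->|jv] := eqVneq j v; rewrite ?(negPf vW) /=.
- by ring.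
- by case: (boolP (j \in W)) => jW /=; ring.
- by case: (boolP (i \in W)) => iW /=; ring.
- case: (boolP (i \in W)); case: (boolP (j \in W)) => jW iW /=.
  + by ring.
  + by rewrite M0 //; ring.
  + by rewrite symM M0 //; ring.
  + by ring.
Qed.

(** Let f and g be the forms of the two sides, both counting the entry at v.
    Two nonnegative vectors with v-coordinate 1 can be glued along v, whence
    M v v - f x <= g y for all such x and y.  Any a separating the two ranges
    works: by homogeneity for the vectors that are nonzero at v, and because the
    two sides are copositive for the others.  Here a is the supremum of the
    left-hand sides. *)
Lemma COP_cut_split M v W : COP R s M -> v \notin W ->
  (forall i j, i \in W -> j \notin W -> j != v -> M i j = 0) ->
  exists a : R,
    COP R s (restrict (v |: W) M + (a - M v v) *: delta_mx v v) /\
    COP R s (restrict (~: W) M + (- a) *: delta_mx v v).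
Proof.
move=> cM vW M0; have /COPP [sM H] := cM.
pose f := qf (restrict (v |: W) M); pose g := qf (restrict (~: W) M).
have f0 x : (forall i, 0 <= x i) -> 0 <= f x.
  by move=> x0; have /COPP [_ ->] := COP_restrict (v |: W) cM.
have g0 x : (forall i, 0 <= x i) -> 0 <= g x.
  by move=> x0; have /COPP [_ ->] := COP_restrict (~: W) cM.
have fg x y : (forall i, 0 <= x i) -> (forall i, 0 <= y i) ->
    x v = 1 -> y v = 1 -> M v v - f x <= g y.
  move=> x0 y0 xv yv.
  pose z i := if i \in W then x i else y i.
  have : 0 <= qf M z by apply: H => i; rewrite /z; case: ifP.
  rewrite [X in qf X _](cut_decomposition sM vW M0) !qfD qfZ qf_delta.
  rewrite /z (negPf vW) yv.
  have -> : qf (restrict (v |: W) M) z = f x.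
    rewrite /f !qf_restrict; congr (qf M _); apply/funext => i; rewrite !inE /z.
    have [->|_] := eqVneq i v; first by rewrite (negPf vW) xv yv.
    by case: (i \in W).
  have -> : qf (restrict (~: W) M) z = g y.
    rewrite /g !qf_restrict; congr (qf M _); apply/funext => i; rewrite !inE /z.
    by case: ifP => // /negPf ->.
  by lra.
pose e i : R := (i == v)%:R.
have e0 i : 0 <= e i by rewrite ler0n.
have ev : e v = 1 by rewrite /e eqxx.
pose S : set R := [set c | exists x,
  [/\ forall i, 0 <= x i, x v = 1 & c = M v v - f x]]%classic.
have Sne : (S !=set0)%classic by exists (M v v - f e), e.
have Sub : has_ubound S by exists (g e) => _ [x [x0 xv ->]]; apply: fg.
have normalize x : (forall i, 0 <= x i) -> 0 < x v ->
    exists y : 'I_s -> R,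
      [/\ x = (fun i => x v * y i), y v = 1 & forall i, 0 <= y i].
  move=> x0 xv; exists (fun i => x i / x v); split.
  - by apply/funext => i; field; rewrite gt_eqF.
  - by rewrite divff // gt_eqF.
  - by move=> i; apply: divr_ge0.
exists (sup S); split; apply/COPP; split.
- by rewrite linearD linearZ /= restrict_sym // trmx_delta.
- move=> x x0; rewrite qfD qfZ qf_delta -/(f x).
  have [xv|xv] := eqVneq (x v) 0.
    by rewrite xv expr0n mulr0 addr0 f0.
  have {}xv : 0 < x v by rewrite lt_neqAle eq_sym xv x0.
  have [y [-> yv y0]] := normalize x x0 xv.
  rewrite /f qf_homog -/f yv mulr1 [_ * _ ^+ 2]mulrC -mulrDr.
  apply: mulr_ge0; first exact: sqr_ge0.
  have : M v v - f y <= sup S by apply: ub_le_sup => //; exists y.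
  by rewrite /f; lra.
- by rewrite linearD linearZ /= restrict_sym // trmx_delta.
- move=> x x0; rewrite qfD qfZ qf_delta -/(g x).
  have [xv|xv] := eqVneq (x v) 0.
    by rewrite xv expr0n mulr0 addr0 g0.
  have {}xv : 0 < x v by rewrite lt_neqAle eq_sym xv x0.
  have [y [-> yv y0]] := normalize x x0 xv.
  rewrite /g qf_homog -/g yv mulr1 [_ * _ ^+ 2]mulrC -mulrDr.
  apply: mulr_ge0; first exact: sqr_ge0.
  have : sup S <= g y by apply: ge_sup => // _ [z [z0 zv ->]]; apply: fg.
  by rewrite /g; lra.
Qed.

(** * Copositive matrices supported on a cycle *)

Definition cyclic_adj (c : seq 'I_s) : rel 'I_s :=
  fun i j => (next c i == j) || (next c j == i).

Definition cycle_support (c : seq 'I_s) M :=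
  forall i j, M i j != 0 ->
  [/\ i \in c, j \in c & i != j -> cyclic_adj c i j].

(** Deleting the head k of a cyclic sequence redirects the predecessor of k to
    the successor of k. *)
Lemma next_behead (k : 'I_s) c i : uniq (k :: c) -> i \in c ->
  next c i = if next (k :: c) i == k then next (k :: c) k else next (k :: c) i.
Proof.
rewrite cons_uniq => /andP [kc _] ic.
have ki : k != i by apply: contraNneq kc => ->.
have -> : next (k :: c) k = nth k c 0 by rewrite next_nth mem_head /= eqxx.
have -> : next (k :: c) i = nth k c (index i c).+1.
  by rewrite next_nth inE ic orbT /= (negPf ki).
rewrite next_nth ic; case: c kc ic => // a c kc ic /=.
have [lt|le] := ltnP (index i (a :: c)) (size c).
  have : nth k c (index i (a :: c)) != k.
    by apply: contraNneq kc => {1}<-; rewrite inE mem_nth ?orbT.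
  by move=> /negPf -> ; apply: set_nth_default.
by rewrite !nth_default // eqxx.
Qed.

Lemma cyclic_adj_behead (k : 'I_s) c i j :
  uniq (k :: c) -> i \in c -> j \in c ->
  cyclic_adj (k :: c) i j -> cyclic_adj c i j.
Proof.
move=> u ic jc; have kc : k \notin c by move: u => /andP [].
have ik : i != k by apply: contraNneq kc => <-.
have jk : j != k by apply: contraNneq kc => <-.
rewrite /cyclic_adj (next_behead u ic) (next_behead u jc).
by move=> /orP [] /eqP ->; rewrite ?(negPf ik) ?(negPf jk) eqxx ?orbT.
Qed.

(** The two neighbours of k become adjacent when k is deleted. *)
Lemma cyclic_adj_skip (k : 'I_s) c i j : uniq (k :: c) -> i \in c -> j \in c ->
  i != j -> cyclic_adj (k :: c) k i -> cyclic_adj (k :: c) k j ->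
  cyclic_adj c i j.
Proof.
move=> u ic jc ij; rewrite /cyclic_adj (next_behead u ic) (next_behead u jc).
move=> /orP [] /eqP Ei /orP [] /eqP Ej.
- by rewrite -Ei -Ej eqxx in ij.
- by rewrite Ej eqxx Ei eqxx orbT.
- by rewrite Ei eqxx Ej eqxx.
- by move: ij; rewrite -(prev_next u i) -(prev_next u j) Ei Ej eqxx.
Qed.

Lemma cycle_support_rot n c M : uniq c ->
  cycle_support c M -> cycle_support (rot n c) M.
Proof.
move=> u H i j /H [ic jc ij]; split; rewrite ?mem_rot // => /ij.
by rewrite /cyclic_adj !next_rot.
Qed.

Lemma cycle_support_restrict W c M :
  cycle_support c M -> cycle_support c (restrict W M).
Proof.
by move=> H i j; rewrite mxE; case: ifP => _; [apply: H|rewrite eqxx].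
Qed.

Lemma cycle_support_behead k c M : uniq (k :: c) -> COP R s M ->
  (forall j, M k j = 0) -> cycle_support (k :: c) M -> cycle_support c M.
Proof.
move=> u cM M0 H i j Mij; have [ic jc ij] := H _ _ Mij.
have ik : i != k by apply: contraNneq Mij => ->; rewrite M0.
have jk : j != k by apply: contraNneq Mij => ->; rewrite (COP_sym _ _ cM) M0.
move: ic jc; rewrite !inE (negPf ik) (negPf jk) /= => ic jc.
by split=> // /ij; apply: cyclic_adj_behead.
Qed.

(** The new nonzero entries of the Schur complement lie between two neighbours
    of k, and these are adjacent in the cycle that bypasses k. *)
Lemma cycle_support_schur k c M : uniq (k :: c) -> COP R s M -> M k k != 0 ->
  cycle_support (k :: c) M -> cycle_support c (schur k M).
Proof.
move=> u cM Mk H i j; rewrite !mxE => Sij.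
have ik : i != k.
  apply: contraNneq Sij => ->; rewrite mulrA mulVf // mul1r subrr //.
have jk : j != k.
  apply: contraNneq Sij => ->.
  by rewrite [M k i * _]mulrC mulrA mulVf // mul1r (COP_sym _ _ cM) subrr.
have inc l : l \in k :: c -> l != k -> l \in c.
  by rewrite inE => /orP [->|].
have [Mij|/H [ic jc ij]] := eqVneq (M i j) 0; last first.
  have {}ic := inc _ ic ik; have {}jc := inc _ jc jk.
  by split=> // /ij; apply: cyclic_adj_behead.
move: Sij; rewrite Mij sub0r oppr_eq0 !mulf_eq0 !negb_or.
move=> /and3P [_ /H [_ ic adji] /H [_ jc adjj]].
have {}ic := inc _ ic ik; have {}jc := inc _ jc jk.
split=> // ij; apply: (cyclic_adj_skip u) => //.
  by apply: adji; rewrite eq_sym.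
by apply: adjj; rewrite eq_sym.
Qed.

(** Elimination or splitting shortens the cycle, as sketched at the top.
    Sequences of length at most two, which stand for a vertex or an edge, arise
    here as arcs of longer cycles. *)
Lemma SPN_cycle c M : uniq c -> COP R s M -> cycle_support c M -> SPN R s M.
Proof.
have [n] := ubnP (size c); elim: n c M => // n IH c M.
rewrite ltnS => sc u cM cS.
have [/hasP [k kc /forallP Mk]|/hasPn noelim] :=
  boolP (has (fun k => [forall i, (i != k) ==> (M k i <= 0)]) c).
  have [r c' E] := rot_to kc.
  have u' : uniq (k :: c') by rewrite -E rot_uniq.
  have cS' : cycle_support (k :: c') M by rewrite -E; apply: cycle_support_rot.
  have sc' : (size c' < n)%N by rewrite -(size_rot r) E in sc.
  have uc' : uniq c' by case/andP: u'.
  have {}Mk i : i != k -> M k i <= 0 by apply/implyP.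
  (* a zero diagonal entry forces row k to be nonnegative, hence zero *)
  have [Mkk|Mkk] := eqVneq (M k k) 0.
    apply: (IH c') => //; apply: (@cycle_support_behead k) => // j.
    have [->//|jk] := eqVneq j k; apply: le_anti.
    by rewrite Mk //= COP_zero_diag.
  have Mk0 := COP_diag k cM; apply: (SPN_schur Mk0).
  apply: (IH c') => //; last exact: cycle_support_schur.
  by apply: COP_schur; rewrite // lt_neqAle eq_sym Mkk.
have pos k : k \in c -> exists2 i, i != k & 0 < M k i.
  move=> /noelim; rewrite negb_forall => /existsP [i].
  by rewrite negb_imply -ltNge => /andP []; exists i.
case: c => [|a c0] in sc u cS noelim pos *.
  apply: nonneg_SPN; split=> [|i j]; first by case: cM.
  by have [->//|/cS []] := eqVneq (M i j) 0.
(* some edge l-k carries a positive entry; the cycle is rotated to start at k *)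
have [k [l [kc lk Ml Enext]]] : exists k l,
    [/\ k \in a :: c0, l != k, 0 < M k l & next (a :: c0) l = k].
  have [b ba Mb] := pos a (mem_head _ _).
  have [_ bc /(_ _) /orP []] := cS a b (lt0r_neq0 Mb); first by rewrite eq_sym.
    by move=> /eqP E; exists b, a; rewrite eq_sym ba (COP_sym _ _ cM).
  by move=> /eqP E; exists a, b; rewrite ba mem_head.
have [r c' E] := rot_to kc.
have {Enext} Enext : next (k :: c') l = k by rewrite -E next_rot.
have {}pos i : i \in k :: c' -> exists2 j, j != i & 0 < M i j.
  by rewrite -E mem_rot; apply: pos.
have {cS} cS : cycle_support (k :: c') M.
  by rewrite -E; apply: cycle_support_rot.
have {u} u : uniq (k :: c') by rewrite -E rot_uniq.
have {sc} sc : (size (k :: c') <= n)%N by rewrite -E size_rot.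
move: {a c0 kc noelim E r} c' Enext pos cS u sc => [|b c'] Enext pos cS u sc.
  have [_] := cS k l (lt0r_neq0 Ml).
  by rewrite inE (negPf lk).
have nk : next [:: k, b & c'] k = b by rewrite /= eqxx.
have bk : b != k.
  by move: u; rewrite /= inE negb_or eq_sym => /andP [/andP []].
case: c' => [|d c'] in Enext pos cS u sc nk *.
  apply: nonneg_SPN; split=> [|i j]; first by case: cM.
  have [->//|/cS [ic jc ij]] := eqVneq (M i j) 0.
  have lb : l = b.
    have [_] := cS k l (lt0r_neq0 Ml).
    by rewrite !inE (negPf lk) => /eqP.
  move: ic jc; rewrite !inE => /orP [] /eqP -> /orP [] /eqP ->;
    rewrite ?COP_diag // -lb ?(COP_sym l k cM) ltW //.
have nb : next [:: k, b, d & c'] b = d.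
  by rewrite /= (negPf bk) eqxx.
have next_inj (x y : 'I_s) :
    next [:: k, b, d & c'] x = next [:: k, b, d & c'] y -> x = y.
  by move=> E; rewrite -(prev_next u x) E prev_next.
(* the positive entry at the second vertex b gives a second positive edge, after
   b in the first case below and before b in the second one *)
have [q qb Mq] : exists2 q, q != b & 0 < M b q.
  by apply: pos; rewrite !inE eqxx orbT.
have [_ _ /(_ _) /orP []] := cS b q (lt0r_neq0 Mq); first by rewrite eq_sym.
  rewrite nb => /eqP dq.
  (* l-k and b-d carry positive entries: the arcs are [k; b] and the rest *)
  have W0 W i : i \notin W -> forall j, restrict W M i j = 0.
    by move=> iW j; rewrite mxE (negPf iW).
  apply: (@SPN_split M [set k; b]) => // [i j||].
  - rewrite !inE => iW /norP [jk jb].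
    have [->//|Mij] := eqVneq (M i j) 0.
    have [_ _ ij] := cS i j Mij.
    case/orP: iW => /eqP Ei; rewrite {i}Ei in Mij ij *.
      have /orP [] : cyclic_adj [:: k, b, d & c'] k j
        by apply: ij; rewrite eq_sym.
        by rewrite nk eq_sym (negPf jb).
      by rewrite -{2}Enext => /eqP /next_inj ->; apply: ltW.
    have /orP [] : cyclic_adj [:: k, b, d & c'] b j
        by apply: ij; rewrite eq_sym.
      by rewrite nb dq => /eqP <-; apply: ltW.
    by rewrite -{2}nk => /eqP /next_inj E; rewrite E eqxx in jk.
  - apply: (IH [:: k; b]); [exact: leq_trans sc|by rewrite /= inE eq_sym bk|
                            exact: COP_restrict|].
    move=> i j; rewrite mxE !inE.
    case: ifP => [/andP [iW jW] _|]; last by rewrite eqxx.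
    split=> // ij; rewrite /cyclic_adj /=.
    by move: ij; case/orP: iW => /eqP ->; case/orP: jW => /eqP ->;
      rewrite ?eqxx ?(negPf bk) /= ?eqxx ?orbT.
  - have uc : uniq (b :: d :: c') by case/andP: u.
    have cMW := COP_restrict (~: [set k; b]) cM.
    apply: (IH (d :: c')) => //; [exact: ltnW|by case/andP: uc|].
    apply: (cycle_support_behead uc cMW).
      by apply: W0; rewrite !inE eqxx orbT.
    apply: (cycle_support_behead u cMW); first by apply: W0; rewrite !inE eqxx.
    exact: cycle_support_restrict.
rewrite -{2}nk => /eqP /next_inj qk.
(* l-k and k-b carry positive entries: the arcs are [k] and the rest *)
have cMW := COP_restrict (~: [set k]) cM.
apply: (@SPN_split M [set k]) => // [i j||].
- rewrite !inE => /eqP -> jk.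
  have [->//|Mkj] := eqVneq (M k j) 0.
  have [_ _ /(_ _) /orP []] := cS k j Mkj; first by rewrite eq_sym.
    by rewrite nk => /eqP <-; rewrite (COP_sym _ _ cM) -qk ltW.
  by rewrite -{2}Enext => /eqP /next_inj ->; apply: ltW.
- apply: (IH [:: k]) => //; [exact: leq_trans sc|exact: COP_restrict|].
  move=> i j; rewrite mxE !inE.
  case: ifP => [/andP [/eqP -> /eqP ->] _|]; last by rewrite eqxx.
  by split=> //; rewrite eqxx.
- apply: (IH [:: b, d & c']) => //; first by case/andP: u.
  apply: (cycle_support_behead u cMW).
    by move=> j; rewrite mxE !inE eqxx.
  exact: cycle_support_restrict.
Qed.

End CopositiveMatrices.

(** * Separations and blocks of graphs *)

Section Blocks.
Set Implicit Arguments.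
Unset Strict Implicit.
Unset Printing Implicit Defensive.
Context {T : finType}.
Implicit Types (G H K B : sgraph T) (U W : {set T}) (x y v : T).

Lemma adjC G x y : adj G x y = adj G y x.
Proof. by rewrite /adj finset.setUC. Qed.

Lemma adj_vset G x y :
  wf_graph G -> adj G x y -> (x \in vset G) && (y \in vset G).
Proof.
move=> /forall_inP wf /wf /andP [/fintype.subsetP sub _].
by rewrite !sub // !inE eqxx ?orbT.
Qed.

(** The separating set is the connected component of a vertex. *)
Lemma disconnected_separation K : wf_graph K -> vset K != finset.set0 ->
  ~~ gconnected K ->
  exists W, [/\ W != finset.set0, W \proper vset K &
    forall x y, x \in W -> y \in vset K -> y \notin W -> ~~ adj K x y].
Proof.
move=> wf /finset.set0Pn [x xK] disc.
exists [set y in vset K | connect (adj K) x y]; split.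
- by apply/finset.set0Pn; exists x; rewrite inE xK connect0.
- rewrite finset.properEneq; apply/andP; split; last first.
    by apply/fintype.subsetP => y; rewrite inE => /andP [].
  apply: contraNneq disc => E.
  have symK : connect_sym (adj K) by apply: sym_connect_sym => y z; apply: adjC.
  rewrite /gconnected /ncomp -(n_comp_connect symK x); apply/eqP.
  apply: eq_n_comp_r => y; rewrite -E inE andb_idl //.
  have clK : fingraph.closed (adj K) (vset K).
    by move=> y' z' /(adj_vset wf) /andP [-> ->].
  by move=> /(closed_connect clK) <-.
- move=> y z; rewrite !inE => /andP [yK xy] zK; rewrite zK /=.
  by apply: contra => yz; apply: connect_trans xy (connect1 yz).
Qed.

Definition induced G U : sgraph T := SGraph U [set e in eset G | e \subset U].

Lemma adj_induced G U x y :
  x \in U -> y \in U -> adj (induced G U) x y = adj G x y.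
Proof.
move=> xU yU.
by rewrite /adj inE finset.subUset !finset.sub1set xU yU !andbT.
Qed.

Lemma subgraph_induced G U : wf_graph G -> U \subset vset G ->
  subgraph (induced G U) G.
Proof.
move=> /forall_inP wf UG; apply/and3P; split => //.
  by apply/forall_inP => e; rewrite inE => /andP [/wf /andP [_ ->] ->].
by apply/fintype.subsetP => e; rewrite inE => /andP [].
Qed.

Lemma del_induced G U v : del_vertex (induced G U) v = induced G (U :\ v).
Proof.
rewrite /del_vertex /induced /=; congr SGraph; apply/setP => e.
by rewrite !inE -andbA finset.subsetD1.
Qed.

(** A block is a subgraph of maximal size, counting vertices and edges, among
    the connected subgraphs without cut vertex that contain H. *)
Lemma block_above G H : subgraph H G -> connected_no_cut H ->
  exists2 B, is_block G B & subgraph H B.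
Proof.
move=> HG cH.
pose size_of B := (#|vset B| + #|eset B|)%N.
pose P n := `[< exists B, [/\ subgraph B G, connected_no_cut B, subgraph H B &
                            size_of B = n] >].
have HH : subgraph H H by case/and3P: HG => wf _ _; apply/and3P.
have exP : exists n, P n by exists (size_of H); apply/asboolP; exists H.
have ubP n : P n -> (n <= #|T| + #|{set T}|)%N.
  by move=> /asboolP [B [_ _ _ <-]]; apply: leq_add; apply: max_card.
case: (ex_maxnP exP ubP) => n /asboolP [B [BG cB HB sB]] maxn.
exists B => //; split=> // K KG cK BK.
have : (size_of K <= size_of B)%N.
  rewrite sB; apply: maxn; apply/asboolP; exists K; split => //.
  case/and3P: BK => _ v1 e1; case/and3P: HB => wf v2 e2.
  apply/and3P; split=> //; first exact: fintype.subset_trans v2 v1.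
  exact: fintype.subset_trans e2 e1.
case/and3P: BK => _ vBK eBK; rewrite /size_of => le.
have vle := subset_leq_card vBK; have ele := subset_leq_card eBK.
have vE : vset B = vset K.
  apply/eqP; rewrite eqEcard vBK -(leq_add2r #|eset K|).
  by rewrite (leq_trans le) ?leq_add2l.
have eE : eset B = eset K.
  apply/eqP; rewrite eqEcard eBK -(leq_add2l #|vset K|).
  by rewrite (leq_trans le) ?leq_add2r.
by case: B K vE eE {HB sB BG cB KG cK le vle ele vBK eBK}
   => [? ?] [? ?] /= -> ->.
Qed.

Lemma ncomp0 G : vset G = finset.set0 -> ncomp G = 0.
Proof.
move=> E; rewrite /ncomp /n_comp_mem; apply: eq_card0 => x.
by rewrite !inE E inE andbF.
Qed.

End Blocks.

(** * Copositive matrices supported on a cactus *)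

Section Assembly.
Set Implicit Arguments.
Unset Strict Implicit.
Unset Printing Implicit Defensive.
Context {R : realType} {s : nat}.
Implicit Types (M : 'M[R]_s) (G B : sgraph 'I_s) (U W : {set 'I_s}).

Definition graph_support G U M :=
  forall i j, M i j != 0 -> [/\ i \in U, j \in U & i != j -> adj G i j].

Lemma graph_support_restrict G U W M :
  graph_support G U M -> graph_support G (U :&: W) (restrict W M).
Proof.
move=> H i j; rewrite mxE; case: ifP => [/andP [iW jW]|_]; last by rewrite eqxx.
by move=> /H [iU jU ij]; rewrite !inE iW jW iU jU.
Qed.

Lemma graph_support_add_diag G U M v (c : R) : v \in U ->
  graph_support G U M -> graph_support G U (M + c *: delta_mx v v).
Proof.
move=> vU H i j; rewrite !mxE.
have [->|/H //] := eqVneq (M i j) 0; rewrite add0r.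
case: (i =P v) => [->|_]; case: (j =P v) => [->|_] /=; rewrite ?mulr0 ?eqxx //.
Qed.

(** An edge is treated as a cyclic sequence of length two. *)
Lemma block_cycle_support G B U M :
  is_edge_graph B \/ is_cycle_graph B -> subgraph (induced G U) B ->
  graph_support G U M -> exists2 c, uniq c & cycle_support c M.
Proof.
move=> HB /and3P [_ /fintype.subsetP vUB /fintype.subsetP eUB] MU.
have adjB i j : M i j != 0 -> i != j -> [set i; j] \in eset B.
  move=> /MU [iU jU ij] /ij; rewrite -(adj_induced G iU jU); exact: eUB.
have [c [uc vB eB]] : exists c : seq 'I_s, [/\ uniq c, vset B = [set x in c] &
    eset B \subset [set [set x; next c x] | x in c]].
  case: HB => [[x [y [xy -> ->]]]|[c [uc _ -> ->]]]; last by exists c.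
  exists [:: x; y]; split; first by rewrite /= inE xy.
    by apply/setP => z; rewrite !inE.
  rewrite finset.sub1set; apply/imsetP; exists x; first by rewrite inE eqxx.
  by rewrite /= eqxx.
exists c => // i j Mij; have [iU jU _] := MU i j Mij.
have := vUB _ iU; have := vUB _ jU; rewrite vB !inE => jc ic.
split=> // ij; have := fintype.subsetP eB _ (adjB _ _ Mij ij).
move=> /imsetP [x _ E]; rewrite /cyclic_adj.
have : i \in [set x; next c x] by rewrite -E !inE eqxx.
have : j \in [set x; next c x] by rewrite -E !inE eqxx orbT.
rewrite !inE => /orP [] /eqP Ej /orP [] /eqP Ei; subst i j;
  by rewrite ?eqxx ?orbT // in ij *.
Qed.

(** Induction on U: the vertex set of the induced graph shrinks at each split
    along a component or a cut vertex, until the graph fits into one block. *)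
Lemma SPN_cactus G U M : wf_graph G ->
  (forall B, is_block G B -> is_edge_graph B \/ is_cycle_graph B) ->
  U \subset vset G -> COP R s M -> graph_support G U M -> SPN R s M.
Proof.
move=> wf blocks; have [n] := ubnP #|U|.
elim: n U M => // n IH U M; rewrite ltnS => sU UG cM MU.
pose H := induced G U; have HG : subgraph H G by apply: subgraph_induced.
have wfH : wf_graph H by case/and3P: HG.
have [U0|U0] := eqVneq U finset.set0.
  apply: nonneg_SPN; split=> [|i j]; first by case: cM.
  by have [->//|/MU []] := eqVneq (M i j) 0; rewrite U0 inE.
have [connH|disc] := boolP (gconnected H); last first.
  have [W [W0 WU sep]] := disconnected_separation wfH U0 disc.
  have WsU := proper_sub WU.
  apply: (@SPN_split _ _ M W) => //.
  - move=> i j iW jW; have [->//|Mij] := eqVneq (M i j) 0.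
    have [iU jU ij] := MU _ _ Mij.
    have := sep i j iW jU jW; rewrite adj_induced // ij //.
    by apply: contraNneq jW => <-.
  - apply: (IH (U :&: W));
      [|exact: fintype.subset_trans (finset.subsetIl _ _) UG|
       exact: COP_restrict|exact: graph_support_restrict].
    by rewrite (finset.setIidPr WsU); apply: leq_trans (proper_card WU) sU.
  - apply: (IH (U :&: ~: W));
      [|exact: fintype.subset_trans (finset.subsetIl _ _) UG|
       exact: COP_restrict|exact: graph_support_restrict].
    apply: leq_trans sU; rewrite -finset.setDE; apply: proper_card.
    case/finset.set0Pn: W0 => w wW; apply/properP.
    split; first exact: finset.subsetDl.
    by exists w; rewrite ?inE ?wW ?(fintype.subsetP WsU).
have [[v cut]|nocut] := pselect (exists v, cut_vertex H v); last first.
  have cH : connected_no_cut H.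
    by split=> // v; apply/negP => cut; apply: nocut; exists v.
  have [B /blocks EC HB] := block_above HG cH.
  have [c uc cS] := block_cycle_support EC HB MU.
  exact: SPN_cycle cS.
have /andP [vU] := cut; rewrite (eqP connH) del_induced => lt1.
have U1 : U :\ v != finset.set0.
  apply/eqP => E; by rewrite ncomp0 in lt1.
have wf1 : wf_graph (induced G (U :\ v)).
  have sUv := fintype.subset_trans (finset.subsetDl U [set v]) UG.
  by have /and3P [] := subgraph_induced wf sUv.
have [W [W0 WU sep]] := disconnected_separation wf1 U1 (negbT (gtn_eqF lt1)).
have WsU := proper_sub WU; rewrite /= in WsU WU sep.
have vW : v \notin W.
  by apply/negP => /(fintype.subsetP WsU); rewrite !inE eqxx.
have M0 i j : i \in W -> j \notin W -> j != v -> M i j = 0.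
  move=> iW jW jv; apply/eqP/negPn/negP => /MU [iU jU ij].
  have jUv : j \in U :\ v by rewrite !inE jv.
  have iUv := fintype.subsetP WsU _ iW.
  have := sep i j iW jUv jW; rewrite adj_induced // ij //.
  by apply: contraNneq jW => <-.
have [a [c1 c2]] := COP_cut_split cM vW M0.
have -> : M = (restrict (v |: W) M + (a - M v v) *: delta_mx v v)
            + (restrict (~: W) M + (- a) *: delta_mx v v).
  rewrite addrACA -scalerDl (_ : a - M v v + - a = - M v v); last by ring.
  by apply: cut_decomposition => //; case: cM.
apply: SPN_add.
- apply: (IH (U :&: (v |: W))) => //.
  + apply: leq_trans sU; apply: proper_card; apply/properP.
    split; first exact: finset.subsetIl.
    have /properP [_ [u uU uW]] := WU; move: uU; rewrite !inE => /andP [uv uU].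
    by exists u; rewrite // !inE (negPf uv) (negPf uW) andbF.
  + exact: fintype.subset_trans (finset.subsetIl _ _) UG.
  + apply: graph_support_add_diag; last exact: graph_support_restrict.
    by rewrite !inE vU eqxx.
- apply: (IH (U :&: ~: W)) => //.
  + apply: leq_trans sU; apply: proper_card; apply/properP.
    split; first exact: finset.subsetIl.
    have /finset.set0Pn [w wW] := W0; exists w; last by rewrite !inE wW andbF.
    by have := fintype.subsetP WsU _ wW; rewrite !inE => /andP [].
  + exact: fintype.subset_trans (finset.subsetIl _ _) UG.
  + apply: graph_support_add_diag; last exact: graph_support_restrict.
    by rewrite !inE vU vW.
Qed.

End Assembly.

(** * The dual problems *)

Lemma wf_bipartite (m n : nat) (Omega : {set 'I_m * 'I_n}) :
  wf_graph (bipartite_graph Omega).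
Proof.
apply/forall_inP => _ /imsetP [p _ ->].
by rewrite finset.subsetT cards2 eq_lrshift.
Qed.

Lemma dual_matrix_support (R : realType) (m n : nat) (m_gt0 : (0 < m)%N)
    (Omega : {set 'I_m * 'I_n}) (A : obs Omega -> R)
    (theta r rho mu0 lambda : R) (w : obs Omega -> R) :
  graph_support (bipartite_graph Omega) [set: 'I_(m + n)]
    (dual_matrix m_gt0 A theta r rho mu0 lambda w).
Proof.
move=> i j Dij; rewrite !finset.in_setT; split=> // ij.
apply: contraNT Dij => nadj.
rewrite /dual_matrix !mxE (negPf ij) mulr0n add0r summxE big1 => [|p _].
  rewrite add0r.
  case: (i =P _) => [Ei|_]; last by rewrite /= mulr0.
  by case: (j =P _) => [Ej|_]; rewrite /= ?mulr0 //; rewrite Ei Ej eqxx in ij.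
have pG : adj (bipartite_graph Omega) (lshift n (val p).1) (rshift m (val p).2).
  by apply: imset_f; apply: valP.
have off x y : adj (bipartite_graph Omega) x y -> (i == x) && (j == y) = false.
  by move=> xy; apply/andP => -[/eqP ix /eqP jy]; rewrite ix jy xy in nadj.
by rewrite /Esym eq_lrshift !mxE !off ?addr0 ?mulr0 // adjC.
Qed.

Theorem theorem3p1 (R : realType) (m n : nat)
    (m_gt0 : (0 < m)%N) (n_gt0 : (0 < n)%N)
    (Omega : {set 'I_m * 'I_n}) (A : obs Omega -> R)
    (A_gt0 : forall p : obs Omega, 0 < A p)
    (G_connected : gconnected (bipartite_graph Omega))
    (G_blocks : forall B : sgraph 'I_(m + n),
       is_block (bipartite_graph Omega) B -> is_edge_graph B \/ is_cycle_graph B) :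
  exists r0 rho0 : R, [/\ 0 < r0, 0 < rho0 &
    forall theta r rho : R, theta = 0 \/ theta = 1 -> r0 <= r -> rho0 <= rho ->
      dual_value m_gt0 A theta r rho (SPN R (m + n)) =
      dual_value m_gt0 A theta r rho (COP R (m + n))].
Proof.
(* the feasible sets coincide for every r and rho *)
exists 1, 1; split=> // theta r rho _ _ _.
congr ereal_sup; apply/seteqP; split=> _ [mu0 [lambda [w [[C l0 w0] ->]]]];
  exists mu0, lambda, w; split=> //; split=> //.
  exact: SPN_COP.
apply: (SPN_cactus (wf_bipartite Omega) G_blocks (fintype.subxx _) C).
exact: dual_matrix_support.
Qed.
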